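(* Let $\mathcal{G}=(\mathcal{V},\mathcal{E})$ be a simple undirected graph with $\mathcal{V}=\{1,\dots,n\}$ and let $k\in\{1,\dots,n-1\}$. Then the inequalities $$\sum_{i,j\in\mathcal{S}:\,i<j}X_{ij}\le\sum_{\kappa=1}^{k}\binom{r_\kappa(\mathcal{S})-r_{\kappa-1}(\mathcal{S})}{2}\qquad\text{for all }\mathcal{S}\subseteq\mathcal{V}$$ are valid for $\mathcal{F}_{\mathrm{BSDP}_k}$, i.e., they are satisfied by every $X\in\mathcal{F}_{\mathrm{BSDP}_k}$.
   Context: $\mathcal{F}_{\mathrm{BSDP}_k}$ is the set of symmetric binary matrices $X\in\{0,1\}^{n\times n}$ such that $X_{ij}=0$ for all $\{i,j\}\in\mathcal{E}$ and the $(n+1)\times(n+1)$ matrix $\begin{pmatrix}k&\mathrm{diag}(X)^\top\\ \mathrm{diag}(X)&X\end{pmatrix}$ is positive semidefinite, where $\mathrm{diag}(X)$ is the vector of diagonal entries of $X$. For $\mathcal{S}\subseteq\mathcal{V}$ and $\kappa\in\{1,\dots,k\}$, the $\kappa$-rank $r_\kappa(\mathcal{S})$ is the maximum number of vertices that can be colored in the induced subgraph $\mathcal{G}[\mathcal{S}]$ with at most $\kappa$ colors such that adjacent colored vertices get different colors (each colored vertex receives one color; vertices may be left uncolored), i.e., the maximum number of vertices of a $\kappa$-colorable induced subgraph of $\mathcal{G}[\mathcal{S}]$. Also $r_0(\mathcal{S}):=0$. *)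

(* Defs.v *)
From mathcomp Require Import all_boot all_order all_algebra.
Set Implicit Arguments.
Unset Strict Implicit.
Unset Printing Implicit Defensive.
Import Order.TTheory GRing.Theory Num.Theory.
Local Open Scope ring_scope.

Definition simple_graph (V : finType) (e : rel V) : Prop :=
  symmetric e /\ irreflexive e.

(* A colouring with at most kappa colours of part of the subgraph induced by S:
   [f v = None] means that v is left uncoloured. *)
Definition partial_coloring (V : finType) (e : rel V) (S : {set V})
    (kappa : nat) (f : {ffun V -> option 'I_kappa}) : bool :=
  [forall v, (f v != None) ==> (v \in S)]
  && [forall u, forall v,
        [&& e u v, f u != None & f v != None] ==> (f u != f v)].

Definition kappa_rank (V : finType) (e : rel V) (S : {set V}) (kappa : nat) :
    nat :=
  (\max_(f : {ffun V -> option 'I_kappa} | partial_coloring e S f)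
     #|[set v | f v != None]|)%N.

Lemma kappa_rank0 (V : finType) (e : rel V) (S : {set V}) :
  kappa_rank e S 0 = 0%N.
Proof.
apply/eqP; rewrite -leqn0; apply/bigmax_leqP => f _.
rewrite leqn0 cards_eq0; apply/eqP/setP => v; rewrite !inE.
by case: (f v) => // -[].
Qed.

(* Hence the truncated difference [kappa_rank e S k - kappa_rank e S k.-1] is
   the difference of integers. *)
Lemma kappa_rankS (V : finType) (e : rel V) (S : {set V}) (kappa : nat) :
  (kappa_rank e S kappa <= kappa_rank e S kappa.+1)%N.
Proof.
apply/bigmax_leqP => f /andP[/forallP fS /forallP fe].
pose w : 'I_kappa -> 'I_kappa.+1 := widen_ord (leqnSn kappa).
pose g : {ffun V -> option 'I_kappa.+1} := [ffun v => omap w (f v)].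
have gN v : (g v != None) = (f v != None) by rewrite ffunE; case: (f v).
have -> : [set v | f v != None] = [set v | g v != None].
  by apply/setP => v; rewrite !inE gN.
pose F (h : {ffun V -> option 'I_kappa.+1}) := #|[set v | h v != None]|.
apply: (@leq_bigmax_cond _ (fun h => partial_coloring e S h) F g).
apply/andP; split; first by apply/forallP => v; rewrite gN; apply: fS.
apply/forallP => u; apply/forallP => v; rewrite !gN.
have /forallP/(_ v) := fe u; case: [&& _, _ & _] => //=.
apply: contraNN; rewrite !ffunE => /eqP; case: (f u) (f v) => [a|] [b|] //= [].
by move=> ab; apply/eqP; congr Some; apply: val_inj.
Qed.

Definition psdmx (R : realFieldType) (m : nat) (A : 'M[R]_m) : Prop :=
  A^T = A /\ forall x : 'cV[R]_m, 0 <= (x^T *m A *m x) 0 0.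

Definition diag_col (R : realFieldType) (n : nat) (X : 'M[R]_n) : 'cV[R]_n :=
  \col_i X i i.

Definition F_BSDP (R : realFieldType) (n : nat) (e : rel 'I_n) (k : nat)
    (X : 'M[R]_n) : Prop :=
  [/\ X^T = X,
      forall i j, X i j = 0 \/ X i j = 1,
      forall i j, e i j -> X i j = 0
    & psdmx (block_mx (k%:R%:M : 'M[R]_1) (diag_col X)^T (diag_col X) X)].

(* Main.v *)
Require Import Defs.
From mathcomp Require Import all_boot all_order all_algebra.
From mathcomp Require Import zify lra.
Import Order.TTheory GRing.Theory Num.Theory.
Local Open Scope ring_scope.

(** A binary positive semidefinite [X] is the adjacency matrix of an equivalence
    relation on its support; the border forces at most [k] classes, each of
    which is independent.  Let [s_1 >= ... >= s_k] be the sizes of the traces of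
    the classes on [S], so that the left-hand side is the sum of the
    ['C(s_i, 2)].  The largest [kappa] classes form a partial [kappa]-colouring,
    whence [s_1 + ... + s_kappa <= r_kappa].  Although the increments
    [d_kappa] of the rank need not be monotone, [s] is, so the tangent
    inequality ['C(d, 2) - 'C(s, 2) >= s * (d - s)] and Abel summation
    conclude. *)

(** * Numerical inequalities: tangents and Abel summation *)

Lemma double_bin2 (m : nat) : ('C(m, 2).*2 + m = m * m)%N.
Proof. by rewrite bin2; elim: m => //= m IHm; lia. Qed.

(** Twice the right side minus twice the left is [(d - s) * (d - s - 1)] over the integers, a
    product of consecutive integers. *)
Lemma bin2_tangent (d s : nat) : ('C(s, 2) + s * d <= 'C(d, 2) + s * s)%N.
Proof.
have := double_bin2 d; have := double_bin2 s.
case: (leqP d s) => [/subnKC <-|/ltnW /subnKC <-]; nia.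
Qed.

Lemma leq_sum_weighted (k : nat) (w a b : nat -> nat) :
    {homo w : i j / (i <= j)%N >-> (j <= i)%N} ->
    (forall m, (m <= k)%N -> (\sum_(i < m) a i <= \sum_(i < m) b i)%N) ->
  (\sum_(i < k) w i * a i <= \sum_(i < k) w i * b i)%N.
Proof.
move=> w_dec leab.
(* Subtraction-free form of [w k * \sum (b i - a i) <= \sum w i * (b i - a i)]. Its left side is
   nonnegative, and stating it with the weight just beyond the range lets the induction go
   through. *)
suff: (\sum_(i < k) w i * a i + w k * \sum_(i < k) b i
       <= \sum_(i < k) w i * b i + w k * \sum_(i < k) a i)%N.
  by have := leab k (leqnn k); nia.
elim: k leab => [|k IHk] leab; first by rewrite !big_ord0.
have {}IHk := IHk (fun m lemk => leab m (leqW lemk)).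
have /subnKC := leab _ (leqnn _); have /subnKC := w_dec _ _ (leqnSn k).
move: IHk; rewrite !big_ord_recr /=.
(* [u] is the drop of the weight and [v] the new gap between the partial sums; scaling the gap
   equation by both weights leaves a linear problem. *)
move: (w k - w k.+1)%N (_ - _)%N => u v IHk wE sE.
have := congr1 (muln (w k)) sE; have := congr1 (muln (w k.+1)) sE.
have : (w k.+1 * v <= w k * v)%N by rewrite -wE mulnDl leq_addr.
by move: IHk; rewrite !mulnDr; lia.
Qed.

Lemma sum_bin2_leq (k : nat) (s d : nat -> nat) :
    {homo s : i j / (i <= j)%N >-> (j <= i)%N} ->
    (forall m, (m <= k)%N -> (\sum_(i < m) s i <= \sum_(i < m) d i)%N) ->
  (\sum_(i < k) 'C(s i, 2) <= \sum_(i < k) 'C(d i, 2))%N.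
Proof.
move=> s_dec lesd; have les := leq_sum_weighted k s s d s_dec lesd.
(* The added sum allows the tangent bound term by term; what remains is [les], the weighted
   inequality with [s] as its own weight. *)
rewrite -(leq_add2r (\sum_(i < k) s i * d i)%N) -big_split /=.
apply: leq_trans (_ : _ <= \sum_(i < k) ('C(d i, 2) + s i * s i))%N _.
  by apply: leq_sum => i _; apply: bin2_tangent.
by rewrite big_split leq_add2l.
Qed.

(** * Colour classes and counting of pairs *)

(** Colouring each vertex by the index of its set gives a partial colouring. The sets may be empty,
    which later permits padding. *)
Lemma sum_card_leq_kappa_rank {V : finType} {e : rel V} {S : {set V}}
    {kappa : nat} (B : 'I_kappa -> {set V}) :
    (forall i, B i \subset S) ->
    (forall i, {in B i &, forall u v, ~~ e u v}) ->
    (forall i j, i != j -> [disjoint B i & B j]) ->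
  (\sum_(i < kappa) #|B i| <= kappa_rank e S kappa)%N.
Proof.
move=> BS Be Bdisj.
pose f : {ffun V -> option 'I_kappa} := [ffun v => [pick i | v \in B i]].
have fB v i : f v = Some i -> v \in B i.
  by rewrite ffunE; case: pickP => // j vBj [<-].
have fN v : (f v != None) = (v \in \bigcup_i B i).
  rewrite ffunE; case: pickP => [i vBi|noB]; apply/esym.
    by apply/bigcupP; exists i.
  by apply/negbTE/bigcupP => -[i _]; rewrite noB.
have cover_f : \bigcup_i B i = [set v | f v != None].
  by apply/setP => v; rewrite inE fN.
have -> : (\sum_(i < kappa) #|B i| = #|[set v | f v != None]|)%N.
  by rewrite -cover_f -!sum1_card partition_disjoint_bigcup //=;
     apply: eq_bigr => i _; rewrite sum1_card.
pose F (h : {ffun V -> option 'I_kappa}) := #|[set v | h v != None]|.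
apply: (@leq_bigmax_cond _ (fun h => partial_coloring e S h) F f).
apply/andP; split; apply/forallP => u.
  apply/implyP; rewrite fN => /bigcupP[i _]; exact: (subsetP (BS i)).
apply/forallP => v; apply/implyP => /and3P[euv fu _].
apply/eqP => fuv; case Efu: (f u) fu => [i|] // _.
by have := Be i u v (fB _ _ Efu) (fB _ _ (etrans (esym fuv) Efu)); rewrite euv.
Qed.

Lemma card_ord_pairs (n : nat) (B : {set 'I_n}) :
  (\sum_(i in B) \sum_(j in B | (i < j)%N) 1 = 'C(#|B|, 2))%N.
Proof.
set L := LHS.
have swap : L = (\sum_(i in B) \sum_(j in B | (j < i)%N) 1)%N.
  rewrite /L (exchange_big_dep (mem B)) => [|i j _ /andP[]] //=.
  by apply: eq_bigr => j jB; apply: eq_bigl => i; rewrite jB.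
(* Ordered pairs split into those above, below and on the diagonal. *)
have E : (L + L + #|B| = #|B| * #|B|)%N.
  rewrite {2}swap -!big_split /= -[X in (_ + X = _)%N]sum1_card -big_split /=.
  rewrite -sum_nat_const; apply: eq_bigr => i iB.
  rewrite -[RHS]sum1_card [RHS](bigID (fun j : 'I_n => (i < j)%N)) /= -addnA.
  congr (_ + _)%N; rewrite [RHS](bigD1 i) ?iB ?ltnn //= addnC; congr (_ + _)%N.
  apply: eq_bigl => j; rewrite -leqNgt ltn_neqAle -andbA; congr (_ && _).
  by rewrite andbC.
by have := double_bin2 #|B|; lia.
Qed.

(** * Consequences of positive semidefiniteness *)

(** Tests the bordered matrix on [t] followed by the sum of [y a] times the unit vector at [f a]. As
    [f] need not be injective, short lists of vertices can be used without a case split on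
    coincidences. *)
Lemma F_BSDP_quadratic {R : realFieldType} {n : nat} {e : rel 'I_n} {k : nat}
    {X : 'M[R]_n} (t : R) {I : finType} (f : I -> 'I_n) (y : I -> R) :
    F_BSDP e k X ->
  0 <= k%:R * t ^+ 2 + 2 * t * (\sum_a y a * X (f a) (f a))
       + \sum_a y a * \sum_b y b * X (f a) (f b).
Proof.
pose x : 'cV[R]_n := \col_i \sum_(a | f a == i) y a.
have sum_x (g : 'I_n -> R) : \sum_i x i 0 * g i = \sum_a y a * g (f a).
  rewrite [RHS](partition_big f xpredT) //=; apply: eq_bigr => i _.
  by rewrite mxE mulr_suml; apply: eq_bigr => a /eqP ->.
case=> _ _ _ [_ /(_ (col_mx t%:M x))].
rewrite tr_col_mx mul_row_block mul_row_col tr_scalar_mx !mulmxDl.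
have quad : (x^T *m X *m x) 0 0 = \sum_a y a * \sum_b y b * X (f a) (f b).
  rewrite -mulmxA mxE; apply: etrans (sum_x (fun i => \sum_b y b * X i (f b))).
  apply: eq_bigr => i _; rewrite mxE; congr (_ * _).
  by rewrite -(sum_x (X i)) [LHS]mxE; apply: eq_bigr => j _; rewrite mulrC.
have lin : (x^T *m diag_col X) 0 0 = \sum_a y a * X (f a) (f a).
  rewrite -(sum_x (fun i => X i i)) [LHS]mxE.
  by apply: eq_bigr => i _; rewrite !mxE.
have lin' : ((diag_col X)^T *m x) 0 0 = \sum_a y a * X (f a) (f a).
  rewrite -(sum_x (fun i => X i i)) [LHS]mxE.
  by apply: eq_bigr => i _; rewrite !mxE mulrC.
rewrite !mul_scalar_mx -!scalemxAl !mul_mx_scalar.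
have addE (A B : 'M[R]_1) : (A + B) 0 0 = A 0 0 + B 0 0 by rewrite mxE.
have scaleE c (A : 'M[R]_1) : (c *: A) 0 0 = c * A 0 0 by rewrite mxE.
rewrite !(addE, scaleE) quad lin lin' mxE eqxx mulr1n.
by lra.
Qed.

Lemma F_BSDP_diag {R : realFieldType} {n : nat} {e : rel 'I_n} {k : nat}
    {X : 'M[R]_n} {i j : 'I_n} : F_BSDP e k X -> X i j = 1 -> X i i = 1.
Proof.
move=> hX Xij; have [XT X01 _ _] := hX.
case: (X01 i i) => // Xii.
have Xji : X j i = 1 by rewrite -XT mxE.
(* With [X i i = 0], the vector with -1 at [i] and 1 at [j] gives [X j j - 2 < 0]. *)
have := F_BSDP_quadratic 0 (I := 'I_2) (nth i [:: i; j]) (nth 0 [:: - 1; 1]) hX.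
rewrite !big_ord_recl !big_ord0 /= Xii Xij Xji.
by case: (X01 j j) => ->; lra.
Qed.

Lemma F_BSDP_trans {R : realFieldType} {n : nat} {e : rel 'I_n} {k : nat}
    {X : 'M[R]_n} {i j l : 'I_n} : F_BSDP e k X ->
  X i j = 1 -> X j l = 1 -> X i l = 1.
Proof.
move=> hX Xij Xjl; have [XT X01 _ _] := hX.
case: (X01 i l) => // Xil.
have tr a b : X a b = X b a by rewrite -[in LHS]XT mxE.
(* With [X i l = 0], the signs 1, -1, 1 give [3 - 2 - 2 < 0]. *)
have := F_BSDP_quadratic 0 (I := 'I_3) (nth i [:: i; j; l])
          (nth 0 [:: 1; - 1; 1]) hX.
have Xii := F_BSDP_diag hX Xij.
have Xjj := F_BSDP_diag hX Xjl.
have Xll : X l l = 1 by apply: (F_BSDP_diag (j := j) hX); rewrite tr.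
rewrite !big_ord_recl !big_ord0 /= (tr j i) (tr l i) (tr l j).
by rewrite Xii Xjj Xll Xij Xjl Xil; lra.
Qed.

Lemma F_BSDP_card_orthogonal {R : realFieldType} {n : nat} {e : rel 'I_n}
    {k : nat} {X : 'M[R]_n} {T : {set 'I_n}} : F_BSDP e k X ->
    {in T, forall i, X i i = 1} -> {in T &, forall i j, i != j -> X i j = 0} ->
  (#|T| <= k)%N.
Proof.
move=> hX Xii Xij.
(* Border coordinate 1 and minus the indicator of [T] give [k - 2 * #|T| + #|T| >= 0]. *)
have := F_BSDP_quadratic 1 id (fun i => - (i \in T)%:R) hX.
have sumT (g : 'I_n -> R) : \sum_i - (i \in T)%:R * g i = - \sum_(i in T) g i.
  rewrite -sumrN [RHS]big_mkcond; apply: eq_bigr => i _.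
  by case: (i \in T); rewrite ?mulN1r // oppr0 mul0r.
rewrite (sumT (fun i => X i i)) sumT.
have -> : \sum_(i in T) X i i = #|T|%:R by rewrite -sumr_const; apply: eq_bigr.
have -> : \sum_(i in T) \sum_b - (b \in T)%:R * X i b = - #|T|%:R.
  rewrite -sumr_const -sumrN; apply: eq_bigr => i iT; rewrite sumT; congr (- _).
  rewrite (bigD1 i) //= Xii // big1 ?addr0 // => j /andP[jT ji].
  by rewrite Xij // eq_sym.
by rewrite -(ler_nat R); lra.
Qed.

Lemma F_BSDP_classes {R : realFieldType} {n : nat} {e : rel 'I_n} {k : nat}
    {X : 'M[R]_n} (S : {set 'I_n}) : F_BSDP e k X ->
  exists P : {set {set 'I_n}},
    [/\ trivIset P, (#|P| <= k)%N, {in P, forall B : {set 'I_n}, B \subset S},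
        {in P, forall B : {set 'I_n}, {in B &, forall u v, X u v = 1}}
      & {in S &, forall u v, X u v = 1 ->
          exists2 B : {set 'I_n}, B \in P & (u \in B) && (v \in B)}].
Proof.
move=> hX; have [XT X01 _ _] := hX.
have tr a b : X a b = X b a by rewrite -[in LHS]XT mxE.
(* Reflexivity holds only where the diagonal is 1, so the classes are taken there. *)
pose D := [set i in S | X i i == 1].
pose r : rel 'I_n := fun i j => X i j == 1.
have r_eq : {in D & &, equivalence_rel r}.
  move=> x y z; rewrite !inE => _ _ /andP[_ rzz]; split=> // /eqP rxy.
  apply/eqP/eqP => [rxz | ryz]; last exact: F_BSDP_trans hX rxy ryz.
  by apply: (F_BSDP_trans (j := x) hX) rxz; rewrite tr.
pose P := equivalence_partition r D.
have PD : partition P D := equivalence_partitionP r_eq.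
have /and3P[/eqP covP tiP _] := PD.
have inBlock u v : u \in D -> v \in D -> (v \in pblock P u) = (X u v == 1).
  exact: pblock_equivalence_partition.
exists P; split=> //.
(* One representative per class: [X] restricted to [T] is the identity, which bounds the number of
   classes by [k]. *)
- pose T := transversal P D.
  have PT := transversalP PD; rewrite -(card_transversal PT).
  have TD : {subset T <= D} := subsetP (transversal_sub PT).
  apply: F_BSDP_card_orthogonal hX _ _.
    by move=> i /TD; rewrite inE => /andP[_ /eqP].
  move=> i j iT jT; case: (X01 i j) => // /eqP.
  rewrite -inBlock ?TD // -eq_pblock ?covP ?TD // => /eqP.
  by move/(pblock_inj PT iT jT) => ->; rewrite eqxx.
- move=> B BP; apply: subset_trans (_ : D \subset S); last first.
    by apply/subsetP => i; rewrite inE => /andP[].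
  by rewrite -covP; apply: bigcup_max BP _.
- move=> B BP u v uB vB; apply/eqP.
  have BD w : w \in B -> w \in D by rewrite -covP => wB; apply/bigcupP; exists B.
  by rewrite -inBlock ?BD // (def_pblock tiP BP).
- move=> u v uS vS Xuv.
  have uD : u \in D by rewrite inE uS; apply/eqP/(F_BSDP_diag hX Xuv).
  have vD : v \in D.
    by rewrite inE vS; apply/eqP/(F_BSDP_diag (j := u) hX); rewrite tr.
  exists (pblock P u); first by rewrite pblock_mem ?covP.
  by rewrite mem_pblock covP uD inBlock // Xuv eqxx.
Qed.

(** * Comparison of the blocks with the rank increments *)

Lemma sum_bin2_blocks_leq {V : finType} (e : rel V) {S : {set V}} {k : nat}
    {P : {set {set V}}} :
    trivIset P -> (#|P| <= k)%N -> {in P, forall B : {set V}, B \subset S} ->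
    {in P, forall B : {set V}, {in B &, forall u v, ~~ e u v}} ->
  (\sum_(B in P) 'C(#|B|, 2)
     <= \sum_(1 <= kappa < k.+1)
          'C(kappa_rank e S kappa - kappa_rank e S kappa.-1, 2))%N.
Proof.
move=> tiP Pk PS Pe.
(* The order is reversed, so that the largest blocks come first. *)
pose leB (A B : {set V}) := (#|B| <= #|A|)%N.
pose L := sort leB (enum P).
have memL B : (B \in L) = (B \in P) by rewrite mem_sort mem_enum.
have uniqL : uniq L by rewrite sort_uniq enum_uniq.
have sizeL : (size L <= k)%N by rewrite size_sort -cardE.
have sortedL : sorted leB L by apply: sort_sorted => A B; apply: leq_total.
(* The default pads the list with empty blocks, each contributing ['C(0, 2) = 0]. *)
pose Bl i := nth set0 L i.
have BlP i : Bl i = set0 \/ Bl i \in P.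
  case: (ltnP i (size L)) => iL; first by right; rewrite -memL mem_nth.
  by left; rewrite /Bl nth_default.
rewrite big_add1 big_mkord.
have -> : (\sum_(B in P) 'C(#|B|, 2) = \sum_(i < k) 'C(#|Bl i|, 2))%N.
  rewrite -(eq_bigl _ _ memL) -(big_uniq _ uniqL) (big_nth set0) /=.
  rewrite -(big_mkord xpredT (fun i => 'C(#|Bl i|, 2))) /=.
  rewrite [RHS](big_cat_nat (leq0n (size L)) sizeL) /=.
  rewrite [X in (_ + X)%N]big_nat_cond [X in (_ + X)%N]big1 ?addn0 //.
  by move=> i /andP[/andP[iL _] _]; rewrite /Bl nth_default // cards0.
pose d i := (kappa_rank e S i.+1 - kappa_rank e S i)%N.
apply: (sum_bin2_leq k (fun i => #|Bl i|) d).
  move=> i j ij; case: (ltnP j (size L)) => jL; last first.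
    by rewrite {1}/Bl nth_default // cards0.
  have leB_trans : transitive leB by move=> A B C BA CB; apply: leq_trans CB BA.
  have leB_refl : reflexive leB by move=> A; apply: leqnn.
  have iL := leq_ltn_trans ij jL.
  exact: (sorted_leq_nth leB_trans leB_refl set0 sortedL) iL jL ij.
move=> m _.
(* Telescoping from rank 0; monotonicity of the rank makes the truncated differences exact. *)
have -> : (\sum_(i < m) d i = kappa_rank e S m)%N.
  rewrite -(big_mkord xpredT d) telescope_sumn_in ?kappa_rank0 ?subn0 //.
  by move=> i _; apply: kappa_rankS.
apply: (sum_card_leq_kappa_rank (fun i : 'I_m => Bl i)).
- by move=> i; case: (BlP i) => [->|/PS //]; rewrite sub0set.
- by move=> i; case: (BlP i) => [->|/Pe //] u; rewrite inE.
- move=> i j ij; case: (ltnP i (size L)) => iL; last first.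
    by rewrite /Bl nth_default // -setI_eq0 set0I.
  case: (ltnP j (size L)) => jL; last first.
    by rewrite /Bl [nth _ _ j]nth_default // -setI_eq0 setI0.
  by apply: (trivIsetP tiP); rewrite -?memL ?mem_nth // nth_uniq.
Qed.

Theorem theorem4p4 (R : realFieldType) (n : nat) (e : rel 'I_n)
    (he : simple_graph e) (k : nat) (hk1 : (1 <= k)%N) (hkn : (k <= n - 1)%N)
    (X : 'M[R]_n) (hX : F_BSDP e k X) (S : {set 'I_n}) :
  \sum_(i in S) \sum_(j in S | (i < j)%N) X i j
    <= (\sum_(1 <= kappa < k.+1)
          'C(kappa_rank e S kappa - kappa_rank e S kappa.-1, 2))%N%:R.
Proof.
have [_ X01 Xe _] := hX.
have [P [tiP Pk PS PX SP]] := F_BSDP_classes S hX.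
apply: (@le_trans _ _ (\sum_(B in P) 'C(#|B|, 2))%N%:R); last first.
  (* Blocks are independent: [X] is 1 on a block and 0 on edges. *)
  rewrite ler_nat; apply: sum_bin2_blocks_leq => // B BP u v uB vB.
  by apply/negP => /Xe; rewrite (PX B) // => /eqP; rewrite oner_eq0.
pose m (B : {set 'I_n}) (i j : 'I_n) : nat := (i \in B) && (j \in B).
(* Each entry is at most the number of blocks containing both indices. Exchanging the sums then
   counts pairs block by block. *)
apply: (@le_trans _ _ (\sum_(i in S) \sum_(j in S | (i < j)%N)
                         \sum_(B in P) m B i j)%N%:R).
  rewrite natr_sum; apply: ler_sum => i iS.
  rewrite natr_sum; apply: ler_sum => j /andP[jS _].
  case: (X01 i j) => Xij; rewrite Xij ?ler0n // ler1n.
  have [B BP ijB] := SP i j iS jS Xij.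
  by rewrite (bigD1 B) //= /m ijB.
rewrite ler_nat (eq_bigr _ (fun i _ => exchange_big _ _ _ _ _ _)) exchange_big /=.
apply: leq_sum => B BP; rewrite -card_ord_pairs.
rewrite (big_mkcond (mem S)) (big_mkcond (mem B)) /=; apply: leq_sum => i _.
rewrite /m; case: (i \in B) => /=; last by case: ifP => // _; rewrite big1.
case: ifP => // _; rewrite big_mkcond [leqRHS]big_mkcond /=.
by apply: leq_sum => j _; case: (j \in B); case: (j \in S); case: (i < j)%N.
Qed.
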